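(* Let $a\ge b>0$ and $s>1$. Set $\alpha=1+\frac1s$ and $u_k^{+}=\frac{sk+1}{2(s-1)}$ for $k=0,1,2,\dots$. Then the series $$L_{(s)}^{+}=\frac{2\sqrt{a^2+b^2}}{s-1}\sum_{k=0}^{\infty}\frac{(-1)^k(\alpha)_k}{k!\,u_k^{+}}\left[{}_2F_1\left(-\tfrac12,1;u_k^{+}+1;\tfrac{b^2}{a^2+b^2}\right)+{}_2F_1\left(-\tfrac12,1;u_k^{+}+1;\tfrac{a^2}{a^2+b^2}\right)\right]$$ converges conditionally. It does not converge absolutely.
   Context: $(q)_k=\Gamma(q+k)/\Gamma(q)$ is the Pochhammer symbol and ${}_2F_1(A,B;C;z)=\sum_n\frac{(A)_n(B)_n}{(C)_n}\frac{z^n}{n!}$ is the Gauss hypergeometric function. Convergence refers to the outer series in $k$. *)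

(* Defs.v *)
From Stdlib Require Export Reals Factorial.
From Coquelicot Require Export Coquelicot.
#[global] Open Scope R_scope.

(* Euler's limit  n! n^x / (x (x+1) ... (x+n)), which gives Gamma at every real
   x other than 0, -1, -2, ..., including the negative non-integers that
   the parameter -1/2 below requires; the values at the poles are junk.
   [Rpower 0 x] at n = 0 is irrelevant to the limit. *)
Definition Gamma (x : R) : R :=
  real (Lim_seq (fun n : nat =>
    INR (fact n) * Rpower (INR n) x / prod_f_R0 (fun i => x + INR i) n)).

Definition pochhammer (q : R) (k : nat) : R := Gamma (q + INR k) / Gamma q.

Definition hyp2F1 (A B C z : R) : R :=
  Series (fun n : nat =>
    pochhammer A n * pochhammer B n / pochhammer C n * (z ^ n / INR (fact n))).

Definition alpha (s : R) : R := 1 + 1 / s.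

Definition u_plus (s : R) (k : nat) : R := (s * INR k + 1) / (2 * (s - 1)).

Definition L_plus_prefactor (a b s : R) : R := 2 * sqrt (a ^ 2 + b ^ 2) / (s - 1).

Definition L_plus_summand (a b s : R) (k : nat) : R :=
  (-1) ^ k * pochhammer (alpha s) k / (INR (fact k) * u_plus s k) *
  (hyp2F1 (- (1 / 2)) 1 (u_plus s k + 1) (b ^ 2 / (a ^ 2 + b ^ 2)) +
   hyp2F1 (- (1 / 2)) 1 (u_plus s k + 1) (a ^ 2 / (a ^ 2 + b ^ 2))).

Definition L_plus (a b s : R) : R :=
  L_plus_prefactor a b s * Series (L_plus_summand a b s).

(* Main.v *)
(* Put c_k = (alpha)_k / (k! u_k). Since u_k is proportional to k + 1/s and
   alpha = 1 + 1/s, c_(k+1) / c_k = (k + 1/s) / (k + 1), so c_k decreases, tends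
   to 0 and dominates a multiple of 1/k. All coefficients of 2F1(-1/2, 1; C; z)
   except the first are negative, so this function is 1 - T(C, z) with T >= 0
   decreasing in C, and T(C, z) <= z for C >= 1 because the coefficients of
   1 - sqrt(1 - z) sum to at most 1. As the two arguments z1, z2 add up to 1, the
   bracket is 2 - G_k with G_k decreasing in [0, 1]; Leibniz's test applies to
   2 sum (-1)^k c_k and to sum (-1)^k c_k G_k, while c_k (2 - G_k) >= c_k is not
   summable. *)
Require Import Defs.
From Stdlib Require Import Reals Lra Lia.
From Coquelicot Require Import Coquelicot.

(** * Euler's limit and the functional equation of Gamma *)

(** The tangent line of ln at [p] lies above its graph. As [p] and [q] come in either order,
    exchanging them yields the matching lower bound. *)
Lemma ln_sub_le (p q : R) : 0 < p -> 0 < q -> ln q - ln p <= (q - p) / p.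
Proof.
  intros Hp Hq.
  rewrite <- ln_div by assumption.
  assert (Hqp : 0 < q / p) by (apply Rdiv_lt_0_compat; assumption).
  assert (H := exp_ineq1_le (ln (q / p))).
  rewrite exp_ln in H by assumption.
  replace ((q - p) / p) with (q / p - 1) by (field; lra).
  lra.
Qed.

Definition euler_seq (x : R) (n : nat) : R :=
  INR (fact n) * Rpower (INR n) x / prod_f_R0 (fun i => x + INR i) n.

Lemma prod_f_R0_pos (f : nat -> R) (n : nat) :
  (forall i, 0 < f i) -> 0 < prod_f_R0 f n.
Proof.
  intros Hf; induction n as [|n IH]; simpl; [apply Hf|].
  apply Rmult_lt_0_compat; [exact IH | apply Hf].
Qed.

Lemma prod_f_R0_neq_0 (f : nat -> R) (n : nat) :
  (forall i, f i <> 0) -> prod_f_R0 f n <> 0.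
Proof.
  intros Hf; induction n as [|n IH]; simpl; [apply Hf|].
  apply Rmult_integral_contrapositive_currified; [exact IH | apply Hf].
Qed.

Lemma euler_seq_pos (x : R) (n : nat) : 0 < x -> 0 < euler_seq x n.
Proof.
  intros Hx; unfold euler_seq.
  apply Rdiv_lt_0_compat.
  - apply Rmult_lt_0_compat; [apply INR_fact_lt_0 | apply exp_pos].
  - apply prod_f_R0_pos; intros i; generalize (pos_INR i); lra.
Qed.

(** The logarithm turns convergence of the quotients into convergence of a series of increments. The
    identity covers n = 0 too, since [Rpower] is exp (x * ln _) whatever the value of [ln 0]. *)
Lemma ln_euler_seq_S (x : R) (n : nat) : 0 < x ->
  ln (euler_seq x (S n)) - ln (euler_seq x n) =
  ln (INR n + 1) + x * (ln (INR n + 1) - ln (INR n)) - ln (x + (INR n + 1)).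
Proof.
  intros Hx; unfold euler_seq.
  assert (Hn := pos_INR n).
  assert (HP : forall k, 0 < prod_f_R0 (fun i => x + INR i) k).
  { intros k; apply prod_f_R0_pos; intros i; generalize (pos_INR i); lra. }
  assert (Hln : forall k, ln (INR (fact k) * Rpower (INR k) x / prod_f_R0 (fun i => x + INR i) k)
    = ln (INR (fact k)) + x * ln (INR k) - ln (prod_f_R0 (fun i => x + INR i) k)).
  { intros k; rewrite ln_div; [|apply Rmult_lt_0_compat; [apply INR_fact_lt_0 | apply exp_pos]|apply HP].
    rewrite ln_mult; [|apply INR_fact_lt_0|apply exp_pos].
    unfold Rpower; rewrite ln_exp; reflexivity. }
  rewrite !Hln, fact_simpl, mult_INR, S_INR.
  change (prod_f_R0 (fun i => x + INR i) (S n)) with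
    (prod_f_R0 (fun i => x + INR i) n * (x + INR (S n))).
  rewrite S_INR, !ln_mult; [ring | apply HP | lra | lra | apply INR_fact_lt_0].
Qed.

(* The elementary bounds on ln make the increments of ln (euler_seq x) lie
   between 0 and x (1 + x) (1/n - 1/(n+1)). *)
Lemma euler_seq_cv_pos (x : R) : 0 < x ->
  exists l : R, 0 < l /\ is_lim_seq (euler_seq x) l.
Proof.
  intros Hx.
  (* The shift by one keeps [INR n] positive, as the bounds on ln require. *)
  set (u := fun n => ln (euler_seq x (S n))).
  assert (Hstep : forall n, 0 <= u (S n) - u n <=
    x * (1 + x) * (1 / INR (S n) - 1 / INR (S (S n)))).
  { intros n; unfold u; rewrite ln_euler_seq_S by assumption.
    rewrite (S_INR (S n)).
    assert (Hm : 0 < INR (S n)) by (apply lt_0_INR; lia).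
    set (m := INR (S n)) in *.
    assert (H1 := ln_sub_le m (m + 1) Hm ltac:(lra)).
    assert (H2 := ln_sub_le (m + 1) m ltac:(lra) Hm).
    assert (H3 := ln_sub_le (m + 1) (x + (m + 1)) ltac:(lra) ltac:(lra)).
    assert (H4 := ln_sub_le (x + (m + 1)) (m + 1) ltac:(lra) ltac:(lra)).
    set (p := ln (m + 1)) in *; set (q := ln m) in *; set (r := ln (x + (m + 1))) in *.
    assert (H1' : x * (p - q) <= x * ((m + 1 - m) / m)) by (apply Rmult_le_compat_l; lra).
    assert (H2' : x * ((m + 1 - m) / (m + 1)) <= x * (p - q)).
    { apply Rmult_le_compat_l; [lra|].
      replace ((m + 1 - m) / (m + 1)) with (- ((m - (m + 1)) / (m + 1))) by (field; lra). lra. }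
    split.
    - replace (x * ((m + 1 - m) / (m + 1))) with ((x + (m + 1) - (m + 1)) / (m + 1)) in H2' by (field; lra).
      lra.
    - apply Rle_trans with (x * ((m + 1 - m) / m) + (m + 1 - (x + (m + 1))) / (x + (m + 1))); [lra|].
      apply Rminus_le_0.
      replace (_ - _) with (x * (1 + x) * x / (m * (m + 1) * (x + (m + 1)))) by (field; lra).
      apply Rdiv_le_0_compat; repeat apply Rmult_lt_0_compat || apply Rmult_le_pos; lra. }
  destruct (ex_finite_lim_seq_incr u (u 0%nat + x * (1 + x))) as [l Hl].
  { intros n; specialize (Hstep n); lra. }
  { intros n.
    assert (Hxx : 0 <= x * (1 + x)) by (apply Rmult_le_pos; lra).
    (* The telescoped sum of the step bounds is a sharper statement, and the one that passes through
       the induction. *)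
    enough (u n <= u 0%nat + x * (1 + x) * (1 - 1 / INR (S n))).
    { assert (0 <= x * (1 + x) * (1 / INR (S n))).
      { apply Rmult_le_pos; [lra|].
        apply Rdiv_le_0_compat; [lra | apply lt_0_INR; lia]. }
      lra. }
    induction n as [|n IH]; [simpl; lra|].
    specialize (Hstep n); lra. }
  exists (exp l); split; [apply exp_pos|].
  apply is_lim_seq_incr_1.
  apply is_lim_seq_ext with (fun n => exp (u n)).
  { intros n; unfold u; apply exp_ln, euler_seq_pos, Hx. }
  apply (is_lim_seq_continuous exp u l); [|exact Hl].
  apply derivable_continuous_pt, derivable_pt_exp.
Qed.

(** The equation Gamma (x + 1) = x Gamma x before the limit: moving from [x] to [x + 1] drops the
    factor [x] of the product and appends one factor at the end, which accounts for the quotient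
    tending to 1. The index [S n] keeps the base of [Rpower] positive. *)
Lemma euler_seq_succ_arg (x : R) (n : nat) : (forall i, x + INR i <> 0) ->
  euler_seq (x + 1) (S n) =
  euler_seq x (S n) * (x * (INR (S n) / (INR (S n) + (x + 1)))).
Proof.
  intros Hx.
  assert (Hprod : forall k, prod_f_R0 (fun i => x + 1 + INR i) k * x =
     prod_f_R0 (fun i => x + INR i) k * (x + INR (S k))).
  { induction k as [|k IH]; [simpl; ring|].
    cbn [prod_f_R0].
    rewrite Rmult_assoc, (Rmult_comm _ x), <- Rmult_assoc, IH, !S_INR; ring. }
  specialize (Hprod (S n)).
  unfold euler_seq.
  assert (Hm : 0 < INR (S n)) by (apply lt_0_INR; lia).
  rewrite Rpower_plus, Rpower_1 by exact Hm.
  assert (HP0 : prod_f_R0 (fun i => x + INR i) (S n) <> 0)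
    by (apply prod_f_R0_neq_0; exact Hx).
  assert (HP1 : prod_f_R0 (fun i => x + 1 + INR i) (S n) <> 0).
  { apply prod_f_R0_neq_0; intros i; specialize (Hx (S i)); rewrite S_INR in Hx; lra. }
  assert (Hx0 := Hx 0%nat); rewrite Rplus_0_r in Hx0.
  assert (HxS := Hx (S (S n))); rewrite S_INR in Hprod, HxS.
  set (P0 := prod_f_R0 (fun i => x + INR i) (S n)) in *.
  set (P1 := prod_f_R0 (fun i => x + 1 + INR i) (S n)) in *.
  set (m := INR (S n)) in *.
  replace P1 with (P0 * (x + (m + 1)) / x) by (rewrite <- Hprod; field; assumption).
  field; repeat split; lra || assumption.
Qed.

Lemma is_lim_seq_ratio_1 (c : R) :
  is_lim_seq (fun n => INR (S n) / (INR (S n) + c)) 1.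
Proof.
  apply is_lim_seq_ext_loc with (fun n => 1 - c * / (INR (S n) + c)).
  (* For negative [c] a denominator may vanish, but not once [INR (S n)] exceeds the absolute value
     of [c]. *)
  - destruct (nfloor_ex (Rabs c)) as [N HN]; [apply Rabs_pos|].
    exists N; intros n Hn; apply le_INR in Hn; rewrite S_INR.
    assert (H := Rle_abs (- c)); rewrite Rabs_Ropp in H.
    field; lra.
  - replace (Finite 1) with (Finite (1 - c * 0)) by (f_equal; ring).
    apply is_lim_seq_minus'; [apply is_lim_seq_const|].
    apply is_lim_seq_mult'; [apply is_lim_seq_const|].
    apply (is_lim_seq_inv _ p_infty); [|discriminate].
    apply is_lim_seq_plus with p_infty c; [|apply is_lim_seq_const|reflexivity].
    apply -> is_lim_seq_incr_1; exact is_lim_seq_INR.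
Qed.

(** Induction on the number M of unit shifts that make [x + M] positive; each shift is undone by
    solving [euler_seq_succ_arg] for [euler_seq x]. The limit must be nonzero because [pochhammer]
    divides by [Gamma q]. *)
Lemma euler_seq_cv (x : R) : (forall i, x + INR i <> 0) ->
  exists l : R, l <> 0 /\ is_lim_seq (euler_seq x) l.
Proof.
  destruct (nfloor_ex (Rabs x)) as [N HN]; [apply Rabs_pos|].
  assert (HxN : 0 < x + INR (S N)).
  { assert (H := Rle_abs (- x)); rewrite Rabs_Ropp in H; rewrite S_INR; lra. }
  clear HN; revert x HxN; generalize (S N) as M.
  induction M as [|M IH]; intros x HxM Hx.
  - simpl in HxM; destruct (euler_seq_cv_pos x) as [l [Hl Hlim]]; [lra|].
    exists l; split; [lra | exact Hlim].
  - destruct (IH (x + 1)) as [l [Hl Hlim]].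
    { rewrite S_INR in HxM; lra. }
    { intros i; specialize (Hx (S i)); rewrite S_INR in Hx; lra. }
    assert (Hx0 := Hx 0%nat); rewrite Rplus_0_r in Hx0.
    (* The factor [/ 1] is the limit of the inverse of the correcting quotient. *)
    exists (l / x * / 1); split.
    { rewrite Rinv_1, Rmult_1_r; unfold Rdiv.
      apply Rmult_integral_contrapositive_currified; [exact Hl | apply Rinv_neq_0_compat; exact Hx0]. }
    apply is_lim_seq_incr_1.
    apply is_lim_seq_ext with (fun n => euler_seq (x + 1) (S n) / x *
       / (INR (S n) / (INR (S n) + (x + 1)))).
    { intros n; rewrite euler_seq_succ_arg by exact Hx.
      assert (INR (S n) <> 0) by (apply not_0_INR; lia).
      specialize (Hx (S (S n))); rewrite S_INR in Hx.
      field; repeat split; assumption || lra. }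
    apply is_lim_seq_mult'.
    + apply is_lim_seq_div'; [|apply is_lim_seq_const|exact Hx0].
      apply -> is_lim_seq_incr_1; exact Hlim.
    + apply (is_lim_seq_inv _ 1); [apply is_lim_seq_ratio_1 | intros H; injection H; lra].
Qed.

Lemma Gamma_lim (x : R) : (forall i, x + INR i <> 0) ->
  Gamma x <> 0 /\ is_lim_seq (euler_seq x) (Gamma x).
Proof.
  intros Hx; destruct (euler_seq_cv x Hx) as [l [Hl Hlim]].
  assert (HG : Gamma x = l).
  { unfold Gamma; change (real (Lim_seq (euler_seq x)) = l).
    rewrite (is_lim_seq_unique _ _ Hlim); reflexivity. }
  rewrite HG; split; assumption.
Qed.

Lemma Gamma_succ (x : R) : (forall i, x + INR i <> 0) -> Gamma (x + 1) = x * Gamma x.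
Proof.
  intros Hx.
  destruct (Gamma_lim x Hx) as [_ H0].
  destruct (Gamma_lim (x + 1)) as [_ H1].
  { intros i; specialize (Hx (S i)); rewrite S_INR in Hx; lra. }
  apply is_lim_seq_incr_1 in H0, H1.
  assert (H2 : is_lim_seq (fun n => euler_seq (x + 1) (S n)) (Gamma x * (x * 1))).
  { apply is_lim_seq_ext with (fun n => euler_seq x (S n) *
      (x * (INR (S n) / (INR (S n) + (x + 1))))).
    { intros n; symmetry; apply euler_seq_succ_arg, Hx. }
    apply is_lim_seq_mult'; [exact H0|].
    apply is_lim_seq_mult'; [apply is_lim_seq_const | apply is_lim_seq_ratio_1]. }
  apply is_lim_seq_unique in H1; apply is_lim_seq_unique in H2.
  rewrite H1 in H2; injection H2; intros ->; ring.
Qed.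

(** * Pochhammer symbols as rising products *)

Lemma pochhammer_0 (q : R) : (forall i, q + INR i <> 0) -> pochhammer q 0 = 1.
Proof.
  intros Hq; unfold pochhammer; rewrite Rplus_0_r.
  apply Rinv_r, Gamma_lim, Hq.
Qed.

Lemma pochhammer_S (q : R) (k : nat) : (forall i, q + INR i <> 0) ->
  pochhammer q (S k) = pochhammer q k * (q + INR k).
Proof.
  intros Hq; unfold pochhammer.
  replace (q + INR (S k)) with (q + INR k + 1) by (rewrite S_INR; ring).
  rewrite Gamma_succ; [unfold Rdiv; ring|].
  intros i; rewrite Rplus_assoc, <- plus_INR; apply Hq.
Qed.

Lemma pos_plus_INR_neq_0 (q : R) : 0 < q -> forall i, q + INR i <> 0.
Proof. intros Hq i; generalize (pos_INR i); lra. Qed.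

Lemma pochhammer_pos (q : R) (k : nat) : 0 < q -> 0 < pochhammer q k.
Proof.
  intros Hq; induction k as [|k IH].
  - rewrite pochhammer_0; [lra | apply pos_plus_INR_neq_0, Hq].
  - rewrite pochhammer_S by apply pos_plus_INR_neq_0, Hq.
    apply Rmult_lt_0_compat; [exact IH | generalize (pos_INR k); lra].
Qed.

Lemma pochhammer_le (p q : R) (k : nat) : 0 < p <= q -> pochhammer p k <= pochhammer q k.
Proof.
  intros Hpq; induction k as [|k IH].
  - rewrite !pochhammer_0 by (apply pos_plus_INR_neq_0; lra); lra.
  - rewrite !pochhammer_S by (apply pos_plus_INR_neq_0; lra).
    assert (Hp := pochhammer_pos p k ltac:(lra)); assert (Hk := pos_INR k).
    apply Rmult_le_compat; lra.
Qed.

Lemma pochhammer_1 (k : nat) : pochhammer 1 k = INR (fact k).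
Proof.
  induction k as [|k IH].
  - apply pochhammer_0, pos_plus_INR_neq_0; lra.
  - rewrite pochhammer_S by (apply pos_plus_INR_neq_0; lra).
    rewrite IH, fact_simpl, mult_INR, S_INR; ring.
Qed.

(** * The function 2F1(-1/2, 1; C; z) on [0, 1] *)

Lemma minus_half_plus_INR_neq_0 : forall i, - (1 / 2) + INR i <> 0.
Proof. intros [|i]; [simpl; lra | rewrite S_INR; generalize (pos_INR i); lra]. Qed.

Lemma pochhammer_minus_half_S (n : nat) :
  pochhammer (- (1 / 2)) (S (S n)) = pochhammer (- (1 / 2)) (S n) * (INR n + 1 / 2).
Proof.
  rewrite (pochhammer_S _ (S n)) by exact minus_half_plus_INR_neq_0.
  rewrite S_INR; f_equal; lra.
Qed.

(** Only the first factor, -1/2, is negative. *)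
Lemma pochhammer_minus_half_neg (n : nat) : pochhammer (- (1 / 2)) (S n) < 0.
Proof.
  induction n as [|n IH].
  - rewrite pochhammer_S, pochhammer_0 by exact minus_half_plus_INR_neq_0; simpl; lra.
  - rewrite pochhammer_minus_half_S.
    assert (0 < - pochhammer (- (1 / 2)) (S n) * (INR n + 1 / 2)).
    { apply Rmult_lt_0_compat; [lra | generalize (pos_INR n); lra]. }
    lra.
Qed.

(* The coefficient of z^(n+1) in 1 - sqrt (1 - z). *)
Definition sqrt_coeff (n : nat) : R := - pochhammer (- (1 / 2)) (S n) / INR (fact (S n)).

Lemma sqrt_coeff_pos (n : nat) : 0 < sqrt_coeff n.
Proof.
  apply Rdiv_lt_0_compat; [generalize (pochhammer_minus_half_neg n); lra | apply INR_fact_lt_0].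
Qed.

(** Telescoping: writing r_N for the subtracted term, the ratio of consecutive coefficients gives
    r_N - r_(N+1) = [sqrt_coeff (S N)]. Positivity of r_N then bounds the partial sums by 1 without
    evaluating the power series at z = 1. *)
Lemma sum_sqrt_coeff (N : nat) :
  sum_n sqrt_coeff N = 1 - 2 * (INR N + 2) * sqrt_coeff (S N).
Proof.
  assert (Hstep : forall n, sqrt_coeff (S n) = sqrt_coeff n * ((INR n + 1 / 2) / (INR n + 2))).
  { intros n; unfold sqrt_coeff.
    rewrite pochhammer_minus_half_S, (fact_simpl (S n)), mult_INR, !S_INR.
    assert (H := INR_fact_neq_0 (S n)); assert (Hn := pos_INR n).
    field; split; lra || exact H. }
  assert (H0 : sqrt_coeff 0 = 1 / 2).
  { unfold sqrt_coeff; rewrite pochhammer_S, pochhammer_0 by exact minus_half_plus_INR_neq_0.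
    simpl; lra. }
  induction N as [|N IH].
  - rewrite sum_O, Hstep, H0; simpl; lra.
  - rewrite sum_Sn, IH, (Hstep (S N)), S_INR; unfold plus; simpl.
    generalize (pos_INR N); intros HN; field; lra.
Qed.

(** The sign makes the terms nonnegative, and no factorial appears because (1)_n cancels n!. The sum
    over n is the T(C, z) of the overview. *)
Definition hyp_tail_term (C z : R) (n : nat) : R :=
  - pochhammer (- (1 / 2)) (S n) / pochhammer C (S n) * z ^ S n.

Definition hyp_tail (C z : R) : R := Series (hyp_tail_term C z).

Lemma hyp_tail_term_nonneg (C z : R) (n : nat) : 0 < C -> 0 <= z ->
  0 <= hyp_tail_term C z n.
Proof.
  intros HC Hz; apply Rmult_le_pos; [|apply pow_le, Hz].
  apply Rdiv_le_0_compat; [|apply pochhammer_pos, HC].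
  generalize (pochhammer_minus_half_neg n); lra.
Qed.

Lemma hyp_tail_term_le (C D z : R) (n : nat) : 0 < C <= D -> 0 <= z ->
  hyp_tail_term D z n <= hyp_tail_term C z n.
Proof.
  intros HCD Hz; apply Rmult_le_compat_r; [apply pow_le, Hz|].
  apply Rmult_le_compat_l; [generalize (pochhammer_minus_half_neg n); lra|].
  apply Rinv_le_contravar; [apply pochhammer_pos; lra | apply pochhammer_le, HCD].
Qed.

(** The terms decrease in [C], so C = 1 is the worst case, and there (1)_n = n! produces
    [sqrt_coeff]. One factor [z] is kept so that the bounds at two arguments of sum 1 add up to
    1. *)
Lemma hyp_tail_term_le_sqrt_coeff (C z : R) (n : nat) : 1 <= C -> 0 <= z <= 1 ->
  hyp_tail_term C z n <= sqrt_coeff n * z.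
Proof.
  intros HC Hz.
  apply Rle_trans with (hyp_tail_term 1 z n); [apply hyp_tail_term_le; lra|].
  unfold hyp_tail_term; rewrite pochhammer_1.
  apply Rmult_le_compat_l; [left; apply sqrt_coeff_pos|].
  apply Rle_trans with (z * 1); [|lra].
  apply Rmult_le_compat_l; [lra|].
  apply Rle_trans with (1 ^ n); [apply pow_incr, Hz | rewrite pow1; lra].
Qed.

Lemma sqrt_coeff_series : ex_series sqrt_coeff /\ Series sqrt_coeff <= 1.
Proof.
  assert (Hle : forall N, sum_n sqrt_coeff N <= 1).
  { intros N; rewrite sum_sqrt_coeff.
    assert (0 < 2 * (INR N + 2) * sqrt_coeff (S N)); [|lra].
    apply Rmult_lt_0_compat; [generalize (pos_INR N); lra | apply sqrt_coeff_pos]. }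
  destruct (ex_finite_lim_seq_incr (sum_n sqrt_coeff) 1) as [l Hl]; [|exact Hle|].
  { intros n; rewrite sum_Sn; unfold plus; simpl; generalize (sqrt_coeff_pos (S n)); lra. }
  assert (Hs : is_series sqrt_coeff l) by exact Hl.
  split; [exists l; exact Hs|].
  rewrite (is_series_unique _ _ Hs).
  apply (is_lim_seq_le _ (fun _ => 1) l 1 Hle Hl), is_lim_seq_const.
Qed.

Lemma ex_series_hyp_tail (C z : R) : 1 <= C -> 0 <= z <= 1 -> ex_series (hyp_tail_term C z).
Proof.
  intros HC Hz; apply (ex_series_le (V := R_CompleteNormedModule)) with (fun n => sqrt_coeff n * z).
  - intros n; unfold norm; simpl; unfold abs; simpl.
    rewrite Rabs_pos_eq by (apply hyp_tail_term_nonneg; lra).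
    apply hyp_tail_term_le_sqrt_coeff; assumption.
  - apply ex_series_scal_r, sqrt_coeff_series.
Qed.

Lemma hyp_tail_le (C D z : R) : 1 <= C <= D -> 0 <= z <= 1 -> hyp_tail D z <= hyp_tail C z.
Proof.
  intros HCD Hz; apply Series_le; [|apply ex_series_hyp_tail; lra].
  intros n; split; [apply hyp_tail_term_nonneg | apply hyp_tail_term_le]; lra.
Qed.

Lemma hyp_tail_bounds (C z : R) : 1 <= C -> 0 <= z <= 1 -> 0 <= hyp_tail C z <= z.
Proof.
  intros HC Hz; destruct sqrt_coeff_series as [Hex Hle]; split.
  (* Zero is rewritten as a series of zero terms, so that [Series_le] gives the lower bound as
     well. *)
  - rewrite <- (Rmult_0_l (Series (fun _ => 0))), <- Series_scal_l.
    apply Series_le; [|apply ex_series_hyp_tail; assumption].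
    intros n; rewrite Rmult_0_l; split; [lra | apply hyp_tail_term_nonneg; lra].
  - apply Rle_trans with (Series (fun n => sqrt_coeff n * z)).
    + apply Series_le; [|apply ex_series_scal_r, Hex].
      intros n; split; [apply hyp_tail_term_nonneg; lra|].
      apply hyp_tail_term_le_sqrt_coeff; assumption.
    + rewrite Series_scal_r.
      apply Rle_trans with (1 * z); [apply Rmult_le_compat_r; lra | lra].
Qed.

Lemma hyp2F1_minus_half_1 (C z : R) : 1 <= C -> 0 <= z <= 1 ->
  hyp2F1 (- (1 / 2)) 1 C z = 1 - hyp_tail C z.
Proof.
  intros HC Hz; unfold hyp2F1, hyp_tail.
  assert (Hterm : forall n, pochhammer (- (1 / 2)) (S n) * pochhammer 1 (S n) /
     pochhammer C (S n) * (z ^ S n / INR (fact (S n))) = - hyp_tail_term C z n).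
  { intros n; unfold hyp_tail_term; rewrite pochhammer_1.
    assert (H := pochhammer_pos C (S n) ltac:(lra)).
    field; split; [lra | apply INR_fact_neq_0]. }
  rewrite Series_incr_1.
  - rewrite (Series_ext _ _ Hterm), Series_opp, !pochhammer_0;
      [simpl; field | apply pos_plus_INR_neq_0; lra .. | exact minus_half_plus_INR_neq_0].
  - apply ex_series_incr_1.
    apply ex_series_ext with (fun n => - hyp_tail_term C z n).
    { intros n; symmetry; apply Hterm. }
    apply (ex_series_opp (hyp_tail_term C z)), ex_series_hyp_tail; assumption.
Qed.

(** * Leibniz's test and the harmonic series *)

Lemma ex_series_alternating (u : nat -> R) :
  (forall n, u (S n) <= u n) -> is_lim_seq u 0 -> ex_series (fun n => (-1) ^ n * u n).
Proof.
  intros Hdec Hlim.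
  destruct (alternated_series u Hdec) as [l Hl]; [apply is_lim_seq_Reals, Hlim|].
  exists l; apply is_series_Reals; exact Hl.
Qed.

Lemma sum_n_S (u : nat -> R) (n : nat) : sum_n u (S n) = sum_n u n + u (S n).
Proof. exact (sum_Sn u n). Qed.

Lemma harmonic_nonneg (n : nat) : 0 <= sum_n (fun k => / INR (S k)) n.
Proof.
  rewrite sum_n_Reals; apply cond_pos_sum; intros k.
  left; apply Rinv_0_lt_compat, lt_0_INR; lia.
Qed.

(** Summing ln (m + 1) - ln m <= 1/m gives ln (n + 2) <= 1 + 1/2 + ... + 1/(n + 1). *)
Lemma harmonic_lim : is_lim_seq (sum_n (fun k => / INR (S k))) p_infty.
Proof.
  apply is_lim_seq_le_p_loc with (fun n => ln (INR (S (S n)))).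
  - exists 0%nat; intros n _; induction n as [|n IH].
    + assert (H := ln_sub_le 1 2 ltac:(lra) ltac:(lra)).
      rewrite ln_1 in H; rewrite sum_O.
      change (INR 2) with (1 + 1); change (INR 1) with 1.
      replace (1 + 1) with 2 by ring; lra.
    + rewrite sum_n_S.
      rewrite (S_INR (S (S n))).
      assert (Hm : 0 < INR (S (S n))) by (apply lt_0_INR; lia).
      set (m := INR (S (S n))) in *.
      assert (H := ln_sub_le m (m + 1) Hm ltac:(lra)).
      replace ((m + 1 - m) / m) with (/ m) in H by (field; lra).
      lra.
  - apply (filterlim_comp _ _ _ (fun n => INR (S (S n))) ln _ (Rbar_locally p_infty)).
    + apply (is_lim_seq_incr_1 (fun n => INR (S n)) p_infty).
      apply (is_lim_seq_incr_1 INR p_infty), is_lim_seq_INR.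
    + exact is_lim_ln_p.
Qed.

Lemma harmonic_diverges : ~ ex_series (fun k => / INR (S k)).
Proof.
  intros [l Hl].
  assert (H : is_lim_seq (sum_n (fun k => / INR (S k))) l) by exact Hl.
  apply is_lim_seq_unique in H; rewrite (is_lim_seq_unique _ _ harmonic_lim) in H.
  discriminate.
Qed.

(** * Sequences with ratio (n + beta) / (n + 1) *)

(* Equivalently, c n = c 0 (beta)_n / n!. *)
Definition ratio_seq (c : nat -> R) (beta : R) : Prop :=
  0 < beta < 1 /\ 0 < c 0%nat /\
  forall n, c (S n) = c n * ((INR n + beta) / (INR n + 1)).

Lemma ratio_seq_pos (c : nat -> R) (beta : R) (n : nat) :
  ratio_seq c beta -> 0 < c n.
Proof.
  intros Hr; pose proof Hr as [Hbeta [Hc0 HcS]].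
  induction n as [|n IH]; [exact Hc0|].
  rewrite HcS; assert (Hn := pos_INR n).
  apply Rmult_lt_0_compat; [exact IH | apply Rdiv_lt_0_compat; lra].
Qed.

Lemma ratio_seq_decr (c : nat -> R) (beta : R) (n : nat) :
  ratio_seq c beta -> c (S n) <= c n.
Proof.
  intros Hr; pose proof Hr as [Hbeta [Hc0 HcS]].
  rewrite HcS; assert (Hn := pos_INR n); assert (Hc := ratio_seq_pos c beta n Hr).
  rewrite <- (Rmult_1_r (c n)) at 2.
  apply Rmult_le_compat_l; [lra|].
  apply Rle_div_l; lra.
Qed.

(** The product [c (S n) * INR (S n)] is nondecreasing in n, since passing to the next index
    replaces the factor n + 1 by n + 1 + beta. Its value at n = 0 is [beta * c 0]. *)
Lemma ratio_seq_ge_harmonic (c : nat -> R) (beta : R) (n : nat) :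
  ratio_seq c beta -> beta * c 0%nat * / INR (S n) <= c (S n).
Proof.
  intros Hr; pose proof Hr as [Hbeta [Hc0 HcS]].
  assert (Hm : forall k, 0 < INR (S k)) by (intros k; apply lt_0_INR; lia).
  enough (beta * c 0%nat <= c (S n) * INR (S n)) as H.
  { apply Rle_div_l; [apply Hm | exact H]. }
  induction n as [|n IH].
  - rewrite HcS; simpl; lra.
  - apply Rle_trans with (1 := IH).
    rewrite (HcS (S n)), (S_INR (S n)).
    assert (Hc := ratio_seq_pos c beta (S n) Hr); specialize (Hm n).
    replace (c (S n) * ((INR (S n) + beta) / (INR (S n) + 1)) * (INR (S n) + 1))
      with (c (S n) * (INR (S n) + beta)) by (field; lra).
    apply Rmult_le_compat_l; lra.
Qed.

(** Each ratio is 1 - d with d = (1 - beta)/(n + 1), and (1 - d)(1 + y + d) <= 1 + y for d, y >= 0,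
    where y is (1 - beta) times the harmonic sum so far. Divergence of the harmonic series then
    forces c to 0. *)
Lemma ratio_seq_harmonic_le (c : nat -> R) (beta : R) (n : nat) :
  ratio_seq c beta ->
  c (S n) * (1 + (1 - beta) * sum_n (fun k => / INR (S k)) n) <= c 0%nat.
Proof.
  intros Hr; pose proof Hr as [Hbeta [Hc0 HcS]].
  induction n as [|n IH].
  - rewrite sum_O, HcS; simpl.
    replace (c 0%nat * ((0 + beta) / (0 + 1)) * (1 + (1 - beta) * / 1))
      with (c 0%nat - c 0%nat * ((1 - beta) * (1 - beta))) by field.
    assert (0 <= c 0%nat * ((1 - beta) * (1 - beta))) by (repeat apply Rmult_le_pos; lra).
    lra.
  - apply Rle_trans with (2 := IH).
    rewrite sum_n_S, (HcS (S n)).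
    assert (HH := harmonic_nonneg n).
    assert (Hm : 0 < INR (S n)) by (apply lt_0_INR; lia).
    rewrite (S_INR (S n)).
    assert (Hc := ratio_seq_pos c beta (S n) Hr).
    set (h := sum_n (fun k => / INR (S k)) n) in *; set (m := INR (S n)) in *.
    replace ((m + beta) / (m + 1)) with (1 - (1 - beta) * / (m + 1)) by (field; lra).
    rewrite Rmult_assoc; apply Rmult_le_compat_l; [lra|].
    assert (Hd : 0 <= (1 - beta) * / (m + 1)).
    { apply Rmult_le_pos; [lra | left; apply Rinv_0_lt_compat; lra]. }
    set (d := (1 - beta) * / (m + 1)) in *.
    replace (1 + (1 - beta) * (h + / (m + 1))) with (1 + (1 - beta) * h + d)
      by (unfold d; ring).
    assert (Hx : 0 <= d * ((1 - beta) * h))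
      by (apply Rmult_le_pos; [lra | apply Rmult_le_pos; lra]).
    assert (Hy : 0 <= d * d) by (apply Rmult_le_pos; lra).
    lra.
Qed.

Lemma ratio_seq_lim (c : nat -> R) (beta : R) :
  ratio_seq c beta -> is_lim_seq c 0.
Proof.
  intros Hr; pose proof Hr as [Hbeta [Hc0 HcS]].
  apply is_lim_seq_incr_1.
  apply is_lim_seq_le_le with (fun _ => 0)
    (fun n => c 0%nat * / (1 + (1 - beta) * sum_n (fun k => / INR (S k)) n)).
  - intros n; split; [left; apply (ratio_seq_pos c beta), Hr|].
    assert (HH := harmonic_nonneg n).
    apply Rle_div_r; [|apply ratio_seq_harmonic_le, Hr].
    assert (0 <= (1 - beta) * sum_n (fun k => / INR (S k)) n) by (apply Rmult_le_pos; lra).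
    lra.
  - apply is_lim_seq_const.
  - replace (Finite 0) with (Finite (c 0%nat * 0)) by (f_equal; ring).
    apply is_lim_seq_mult'; [apply is_lim_seq_const|].
    apply (is_lim_seq_inv _ p_infty); [|discriminate].
    apply is_lim_seq_plus with 1 p_infty; [apply is_lim_seq_const| |reflexivity].
    apply is_lim_seq_mult with (1 - beta) p_infty;
      [apply is_lim_seq_const | exact harmonic_lim |].
    apply is_Rbar_mult_sym, is_Rbar_mult_p_infty_pos; simpl; lra.
Qed.

(** * Conditional convergence of the series *)

Definition L_plus_coeff (s : R) (k : nat) : R :=
  pochhammer (alpha s) k / (INR (fact k) * u_plus s k).

Lemma u_plus_pos (s : R) (k : nat) : s > 1 -> 0 < u_plus s k.
Proof.
  intros Hs; apply Rdiv_lt_0_compat; [|lra].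
  assert (0 <= s * INR k) by (apply Rmult_le_pos; [lra | apply pos_INR]); lra.
Qed.

Lemma u_plus_incr (s : R) (k : nat) : s > 1 -> u_plus s k <= u_plus s (S k).
Proof.
  intros Hs; apply Rmult_le_compat_r; [left; apply Rinv_0_lt_compat; lra|].
  rewrite S_INR; lra.
Qed.

(** The new Pochhammer factor is alpha + k = (s (k + 1) + 1) / s, which cancels the numerator of
    [u_plus s (S k)] up to 1/s. The condition s > 1 is what puts 1/s below 1. *)
Lemma L_plus_coeff_ratio_seq (s : R) : s > 1 -> ratio_seq (L_plus_coeff s) (1 / s).
Proof.
  intros Hs; assert (Hs' : 0 < 1 / s) by (apply Rdiv_lt_0_compat; lra).
  split; [|split].
  - split; [exact Hs' | apply Rlt_div_l; lra].
  - apply Rdiv_lt_0_compat.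
    + apply pochhammer_pos; unfold alpha; lra.
    + apply Rmult_lt_0_compat; [apply INR_fact_lt_0 | apply u_plus_pos, Hs].
  - intros k; unfold L_plus_coeff, u_plus, alpha.
    rewrite pochhammer_S by (apply pos_plus_INR_neq_0; lra).
    rewrite fact_simpl, mult_INR, !S_INR.
    assert (Hk := pos_INR k); assert (Hsk : 0 <= s * INR k) by (apply Rmult_le_pos; lra).
    field; repeat split; try lra; apply INR_fact_neq_0.
Qed.

Theorem theorem4p2 (a b s : R) (hab : a >= b) (hb : b > 0) (hs : s > 1) :
  is_series (fun k : nat => L_plus_prefactor a b s * L_plus_summand a b s k)
    (L_plus a b s) /\
  ~ ex_series (fun k : nat =>
      Rabs (L_plus_prefactor a b s * L_plus_summand a b s k)).
Proof.
  set (c := L_plus_coeff s).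
  assert (Hr : ratio_seq c (1 / s)) by (apply L_plus_coeff_ratio_seq, hs).
  assert (Hcpos := fun k => ratio_seq_pos c _ k Hr).
  assert (Hcdec := fun k => ratio_seq_decr c _ k Hr).
  assert (Hclim := ratio_seq_lim c _ Hr).
  assert (Ha2 : 0 < a ^ 2) by (apply pow_lt; lra).
  assert (Hb2 : 0 < b ^ 2) by (apply pow_lt; lra).
  set (z1 := b ^ 2 / (a ^ 2 + b ^ 2)).
  set (z2 := a ^ 2 / (a ^ 2 + b ^ 2)).
  assert (Hz1 : 0 < z1) by (apply Rdiv_lt_0_compat; lra).
  assert (Hz2 : 0 < z2) by (apply Rdiv_lt_0_compat; lra).
  assert (Hz : z1 + z2 = 1) by (unfold z1, z2; field; lra).
  set (G := fun k => hyp_tail (u_plus s k + 1) z1 + hyp_tail (u_plus s k + 1) z2).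
  assert (Hu := fun k => u_plus_pos s k hs).
  assert (HG : forall k, 0 <= G k <= 1).
  { intros k; specialize (Hu k).
    assert (H1 := hyp_tail_bounds (u_plus s k + 1) z1 ltac:(lra) ltac:(lra)).
    assert (H2 := hyp_tail_bounds (u_plus s k + 1) z2 ltac:(lra) ltac:(lra)).
    unfold G; lra. }
  assert (HGdec : forall k, G (S k) <= G k).
  { intros k; assert (H := u_plus_incr s k hs); specialize (Hu k).
    apply Rplus_le_compat; apply hyp_tail_le; lra. }
  assert (Hsummand : forall k, L_plus_summand a b s k = (-1) ^ k * (c k * (2 - G k))).
  { intros k; specialize (Hu k); unfold L_plus_summand; fold z1 z2.
    rewrite !hyp2F1_minus_half_1 by lra.
    unfold c, G, L_plus_coeff, Rdiv; ring. }
  assert (Hpref : 0 < L_plus_prefactor a b s).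
  { apply Rdiv_lt_0_compat; [|lra].
    apply Rmult_lt_0_compat; [lra | apply sqrt_lt_R0; lra]. }
  split.
  - apply (is_series_scal (L_plus_prefactor a b s) (L_plus_summand a b s)).
    apply Series_correct.
    (* The factor 2 - G increases, so c (2 - G) is not evidently monotone; the two alternating
       series are therefore treated separately. *)
    apply ex_series_ext with
      (fun k => minus (scal 2 ((-1) ^ k * c k)) ((-1) ^ k * (c k * G k))).
    { intros k; rewrite Hsummand; unfold minus, plus, opp, scal; simpl.
      unfold mult; simpl; ring. }
    apply (ex_series_minus (V := R_NormedModule)).
    + apply (ex_series_scal (V := R_NormedModule)).
      apply ex_series_alternating; assumption.
    + apply ex_series_alternating.
      * intros k; specialize (Hcpos (S k)); specialize (HG (S k)).
        apply Rmult_le_compat; auto; lra.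
      * apply is_lim_seq_le_le with (fun _ => 0) c; [|apply is_lim_seq_const|exact Hclim].
        intros k; specialize (Hcpos k); specialize (HG k).
        split; [apply Rmult_le_pos; lra|].
        rewrite <- (Rmult_1_r (c k)) at 2; apply Rmult_le_compat_l; lra.
  - intros Hex; apply harmonic_diverges.
    (* The term k = 0 is dropped, since the harmonic lower bound concerns [c (S k)]. *)
    apply ex_series_incr_1 in Hex.
    (* The prefactor times the constant of [ratio_seq_ge_harmonic] at beta = 1/s. *)
    set (kappa := L_plus_prefactor a b s * (1 / s * c 0%nat)).
    assert (Hkappa : 0 < kappa).
    { destruct Hr as [Hbeta [Hc0 _]];
      apply Rmult_lt_0_compat; [lra | apply Rmult_lt_0_compat; lra]. }
    apply ex_series_ext with (fun k => scal (/ kappa) (kappa * / INR (S k))).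
    { intros k; change (/ kappa * (kappa * / INR (S k)) = / INR (S k)).
      rewrite <- Rmult_assoc, Rinv_l, Rmult_1_l; lra. }
    apply (ex_series_scal (V := R_NormedModule)).
    apply (ex_series_le (V := R_CompleteNormedModule)) with (2 := Hex); intros k.
    change (norm (kappa * / INR (S k))) with (Rabs (kappa * / INR (S k))).
    assert (Hinv : 0 < / INR (S k)) by (apply Rinv_0_lt_compat, lt_0_INR; lia).
    specialize (HG (S k)); specialize (Hcpos (S k)).
    assert (Hge := ratio_seq_ge_harmonic c _ k Hr).
    rewrite Hsummand, !Rabs_mult, pow_1_abs, Rmult_1_l.
    rewrite (Rabs_pos_eq (L_plus_prefactor a b s)), (Rabs_pos_eq kappa),
      (Rabs_pos_eq (c (S k))), (Rabs_pos_eq (/ INR (S k))), Rabs_pos_eq by lra.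
    unfold kappa; rewrite Rmult_assoc; apply Rmult_le_compat_l; [lra|].
    apply Rle_trans with (1 := Hge).
    (* The bracket 2 - G is at least 1 because G <= 1. *)
    rewrite <- (Rmult_1_r (c (S k))) at 1; apply Rmult_le_compat_l; lra.
Qed.
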